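(* Let $n \ge 1$ and $0 \le k \le n-1$, and let the symmetric group $S_n$ act on $\operatorname{stan}_n^k$ by permuting the variables $x_1,\dots,x_n$. Then the number of orbits under this action is \[\sum_{\ell=1}^{k+1}\frac{\ell}{k+1} \binom{2k-\ell+1}{k} \binom{2(n-k)+\ell-2}{n-k+\ell-1}.\]
   Context: Fix a field $\mathbb{K}$ and let $S = \mathbb{K}[x_1,\dots,x_n]$, $[n]=\{1,\dots,n\}$. For nonempty $\sigma \subseteq [n]$ let $m_\sigma = \prod_{i\in\sigma} x_i^{\,n-|\sigma|+1}$. For $0 \le k \le n-1$ let $M_n^{(k)} = \langle m_\sigma : \sigma \subseteq [n],\ 1 \le |\sigma| \le k+1\rangle \subset S$. The standard monomials of a monomial ideal are the monomials of $S$ not lying in the ideal; $\operatorname{stan}_n^k$ denotes the set of standard monomials of $M_n^{(k)}$. Since the generating set of $M_n^{(k)}$ is symmetric in the variables, $S_n$ acts on $\operatorname{stan}_n^k$. *)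

(* Defs.v *)
From mathcomp Require Import all_boot all_order all_algebra all_fingroup.
From mathcomp Require Import mpoly.
From mathcomp Require Import boolp classical_sets functions cardinality.

Set Implicit Arguments.
Unset Strict Implicit.
Unset Printing Implicit Defensive.

Import GRing.Theory.
Local Open Scope classical_set_scope.
Local Open Scope ring_scope.

Definition msigma (K : fieldType) (n : nat) (sigma : {set 'I_n}) : {mpoly K[n]} :=
  \prod_(i in sigma) 'X_i ^+ (n - #|sigma| + 1).
Arguments msigma : clear implicits.

(* The ideal generated by the family (g i), i ranging over P, in a commutative
   ring. *)
Definition ideal_span (R : comNzRingType) (I : finType) (P : pred I)
    (g : I -> R) : set R :=
  [set p | exists c : I -> R, p = \sum_(i | P i) c i * g i].

Definition Mideal (K : fieldType) (n k : nat) : set {mpoly K[n]} :=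
  ideal_span [pred sigma : {set 'I_n} | (1 <= #|sigma| <= k + 1)%N]
             (msigma K n).
Arguments Mideal : clear implicits.

Definition stan (K : fieldType) (n k : nat) : set {mpoly K[n]} :=
  [set p | (exists m : 'X_{1..n}, p = 'X_[m]) /\ ~ Mideal K n k p].
Arguments stan : clear implicits.

(* [msym s] substitutes 'X_(s i) for 'X_i. *)
Definition perm_orbit (K : fieldType) (n : nat) (p : {mpoly K[n]}) :
    set {mpoly K[n]} :=
  [set q | exists s : 'S_n, q = msym s p].

Definition stan_orbits (K : fieldType) (n k : nat) : set (set {mpoly K[n]}) :=
  [set perm_orbit p | p in stan K n k].
Arguments stan_orbits : clear implicits.

(* Main.v *)
(* A monomial x^a is standard iff its exponents, sorted as b_1 >= ... >= b_n,
   satisfy b_j <= n - j for j <= k + 1, since the best choice of sigma of size j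
   is the set of the j largest exponents. As b_{k+1} <= n - k - 1 bounds the
   remaining exponents, orbits correspond to weakly decreasing sequences with
   b_j < max (n - j + 1, n - k). Put m = n - k. The sequences with exactly
   m + l - 1 entries smaller than m split into a free part, counted by
   'C(2m + l - 2, m + l - 1), and a part above m confined by a staircase, counted
   by the ballot number l / (k + 1) * 'C(2k + 1 - l, k). *)
Require Import Defs.
From mathcomp Require Import all_boot all_order all_algebra all_fingroup.
From mathcomp Require Import mpoly.
From mathcomp Require Import boolp classical_sets functions cardinality.
From mathcomp Require Import ring zify.

Set Implicit Arguments.
Unset Strict Implicit.
Unset Printing Implicit Defensive.

Import GRing.Theory.
Local Open Scope ring_scope.

(** * Enumerating bounded weakly decreasing sequences *)

(* The weakly decreasing sequences x_1, ..., x_i with x_1 < v whose entry x_j,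
   which has i - j successors, is smaller than [bound (i - j + 1)]; bounds are
   indexed from the right end so that tails are enumerated by the same [bound]. *)
Fixpoint descents (bound : nat -> nat) (i v : nat) : seq (seq nat) :=
  if i is i'.+1 then
    (fix below v := if v is v'.+1 then
       below v' ++ (if (v' < bound i)%N then map (cons v') (descents bound i' v)
                    else [::])
     else [::]) v
  else [:: [::]].

Lemma descentsSS bound i v :
  descents bound i.+1 v.+1 = descents bound i.+1 v ++
    (if (v < bound i.+1)%N then map (cons v) (descents bound i v.+1) else [::]).
Proof. by []. Qed.

(** The disjunct [(s == [::]) || (0 < v)] settles [v = 0], where [v.-1] alone would still allow the
    head 0. *)
Lemma mem_descents bound i v s :
  (s \in descents bound i v) =
  [&& size s == i, path geq v.-1 s, (s == [::]) || (0 < v)%N &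
      all (fun j => (nth 0 s j < bound (i - j))%N) (iota 0 i)].
Proof.
elim: i v s => [|i IHi] v s.
  by case: s => [|x s]; rewrite inE.
elim: v s => [|v IHv] s; first by rewrite in_nil; case: s => [|x s] //=; rewrite !andbF.
rewrite descentsSS mem_cat IHv {IHv}; case: s => [|x s] /=.
  by case: ifP => // _; apply/negbTE/mapP => -[].
rewrite eqSS subn0 (iotaDl 1 0) all_map /=.
under [all (preim _ _) _]eq_all => j do rewrite /= add1n subSS.
have -> : (x :: s \in if (v < bound i.+1)%N
    then [seq v :: i0 | i0 <- descents bound i v.+1] else [::]) =
    [&& (v < bound i.+1)%N, x == v & s \in descents bound i v.+1].
  case: ifP => //= _; apply/mapP/idP => [[s' ss [-> ->]]|/andP[/eqP -> ss]].
    by rewrite eqxx.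
  by exists s.
rewrite IHi /= orbT /=.
case: (size s == i) => /=; last by rewrite ?andbF.
case: (all _ (iota 0 i)); last by rewrite ?andbF.
rewrite ?andbT; case: (ltngtP x v) => [xv|xv|->] /=.
- by rewrite andbF orbF; case: v xv => //= v; rewrite ltnS => ->; rewrite ?andbT.
- rewrite andbF orbF; case: v xv => [|v] xv; first by rewrite ?andbF.
  by rewrite leqNgt (ltn_trans _ xv).
- by case: v => [|v] /=; rewrite ?ltnn ?andbF //= andbC.
Qed.

Lemma uniq_descents bound i v : uniq (descents bound i v).
Proof.
elim: i v => [|i IHi] v //; elim: v => [|v IHv] //.
rewrite descentsSS cat_uniq IHv /=; case: ifP => // _.
rewrite map_inj_uniq ?IHi ?andbT; last by move=> s t [].
apply/hasPn => _ /mapP[s _ ->].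
suff: v :: s \notin descents bound i.+1 v by [].
rewrite mem_descents /=.
by case: v {IHv} => [|v]; rewrite ?andbF //= ltnn !andbF.
Qed.

Lemma size_descentsSS bound i v :
  size (descents bound i.+1 v.+1) = (size (descents bound i.+1 v) +
    (v < bound i.+1)%N * size (descents bound i v.+1))%N.
Proof. by rewrite descentsSS size_cat; case: ifP; rewrite ?size_map ?mul1n. Qed.

(** Entries below [v <= m] always respect the bound [maxn m i], so these are the multisets of size
    [i] from [v] values, and the recursion is Pascal's. *)
Lemma size_descents_free m i v : (v <= m)%N ->
  size (descents (maxn m) i v) = 'C((i + v).-1, i).
Proof.
elim: i v => [|i IHi] v; first by rewrite bin0.
elim: v => [|v IHv] vm; first by rewrite addn0 bin_small.
rewrite size_descentsSS (IHv (ltnW vm)) IHi // leq_max vm mul1n.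
by rewrite !addSn !addnS binS.
Qed.

(** * Ballot numbers and the count of sequences *)

(* Reflection principle: the number of weakly increasing sequences e_1, ..., e_r
   of naturals with e_j < l + j - 1 and e_j < s, provided s <= l + r. Both terms
   satisfy Pascal's recursion, and they cancel on the line s = l + r + 1. *)
Definition ballot (l r s : nat) : rat :=
  'C((r + s).-1, r)%:R - 'C((r + s).-1, r + l)%:R.

Lemma ballot0 l s : (0 < l)%N -> (s <= l)%N -> ballot l 0 s = 1.
Proof.
by move=> l0 sl; rewrite /ballot bin0 bin_small ?subr0 //; lia.
Qed.

Lemma ballotS0 l r : ballot l r.+1 0 = 0.
Proof. by rewrite /ballot !bin_small ?subr0 //; lia. Qed.

Lemma ballotSS l r s : ballot l r.+1 s.+1 = ballot l r.+1 s + ballot l r s.+1.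
Proof. by rewrite /ballot !addSn !addnS /= !binS !natrD; ring. Qed.

Lemma ballot_diag l r : ballot l r (l + r).+1 = 0.
Proof.
rewrite /ballot addnS /= -bin_sub; last lia.
by rewrite [X in 'C(_, X)](_ : _ = (r + l)%N) ?subrr //; lia.
Qed.

(** With [M = 2k + 1 - l], symmetry makes the first binomial ['C(M, k)], and
    [(k + 1) 'C(M, k + 1) = (M - k) 'C(M, k)] reduces the second to it. *)
Lemma ballotE l k : (0 < l <= k.+1)%N ->
  ballot l (k.+1 - l) k.+1 = l%:R / k.+1%:R * 'C(2 * k + 1 - l, k)%:R.
Proof.
move=> /andP[l0 lk]; rewrite /ballot subnK //.
have -> : ((k.+1 - l + k.+1).-1 = 2 * k + 1 - l)%N by lia.
set M := (2 * k + 1 - l)%N.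
have -> : 'C(M, k.+1 - l) = 'C(M, k).
  by rewrite -bin_sub; [congr 'C(_, _); rewrite /M; lia|rewrite /M; lia].
have E : (k.+1%:R * 'C(M, k.+1)%:R = (k.+1 - l)%:R * 'C(M, k)%:R :> rat).
  by rewrite -!natrM mul_bin_left; congr (_ * _)%:R; rewrite /M; lia.
have k0 : k.+1%:R != 0 :> rat by rewrite Num.Theory.pnatr_eq0.
apply: (mulfI k0); rewrite mulrBr E natrB //; field.
by rewrite -mulrS.
Qed.

(* The [l]-th term counts the sequences whose last [m + l - 1] entries, and no
   others, are smaller than [m]. *)
Lemma size_descents_ballot m t s : (s <= t.+1)%N ->
  (size (descents (maxn m) (m + t) (m + s)))%:R =
  \sum_(1 <= l < t.+2) ballot l (t.+1 - l) s * 'C(2 * m + l - 2, m + l - 1)%:R :> rat.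
Proof.
(* At [s = 0] only the term [l = u + 1] survives; it is the free count for length [m + u] below
   [m]. *)
have HE u : \sum_(1 <= l < u.+2) ballot l (u.+1 - l) 0 * 'C(2 * m + l - 2, m + l - 1)%:R
    = 'C((m + u + m).-1, m + u)%:R.
  rewrite big_nat_recr //= subnn ballot0 // mul1r big_nat big1 ?add0r.
    by congr (_%:R); congr 'C(_, _); lia.
  by move=> l /andP[l0 lt]; rewrite subSn // ballotS0 mul0r.
elim: t s => [|t IHt].
  case=> [|[|s]] // _.
    by rewrite HE !addn0 size_descents_free.
  rewrite big_nat1 subnn ballot0 // mul1r !addn0 addn1.
  case: m {HE} => [|m] //.
  rewrite size_descentsSS maxnn ltnn mul0n addn0 size_descents_free //.
  by congr (_%:R); congr 'C(_, _); lia.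
elim=> [|s IHs] st; first by rewrite addn0 size_descents_free // HE.
rewrite !addnS size_descentsSS natrD -addnS (IHs (ltnW st)).
have -> : (m + s < maxn m (m + t.+1))%N = (s <= t)%N by lia.
rewrite natrM -addnS.
(* At [s = t + 1] the head [m + s] violates its bound, and on the right every ballot number lies on
   the line where it vanishes. *)
have -> : (s <= t)%N%:R * (size (descents (maxn m) (m + t) (m + s.+1)))%:R =
  \sum_(1 <= l < t.+2) ballot l (t.+1 - l) s.+1 * 'C(2 * m + l - 2, m + l - 1)%:R :> rat.
  case: (leqP s t) => [le_st|lt_ts]; first by rewrite mul1r IHt.
  have -> : s = t.+1 by lia.
  rewrite mul0r big_nat big1 // => l /andP[l0 lt].
  by rewrite -{2}(@subnKC l t.+1) // ballot_diag mul0r.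
(* The term [l = t + 2] has ballot number 1 on both sides; the others match by [ballotSS]. *)
rewrite big_nat_recr //= [RHS]big_nat_recr //= addrAC; congr (_ + _).
  rewrite -big_split /=; apply: eq_big_nat => l /andP[l0 lt].
  by rewrite -mulrDl [(t.+2 - l)%N]subSn // ballotSS.
by rewrite subnn !ballot0 // ltnW.
Qed.

(** * Standard monomials through their exponents *)

Lemma msigmaE (K : fieldType) n (sigma : {set 'I_n}) :
  msigma K n sigma = 'X_[(\sum_(i in sigma) U_(i) *+ (n - #|sigma| + 1))%MM].
Proof. exact: mprodXnE. Qed.

Lemma msigma_exponent n (sigma : {set 'I_n}) c i :
  ((\sum_(j in sigma) U_(j) *+ c)%MM i = (i \in sigma) * c)%N.
Proof.
rewrite mnm_sumE; under eq_bigr => j _ do rewrite mulmnE mnm1E.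
case: (boolP (i \in sigma)) => [is_|nis].
  rewrite (bigD1 i) //= eqxx big1 ?addn0 // => j /andP[_ /negbTE ji].
  by rewrite ji.
by rewrite big1 // => j js; case: eqP => // ji; rewrite -ji js in nis.
Qed.

(** The coefficient of [m] in a combination of the generators vanishes unless some [e i] divides
    [m]. *)
Lemma ideal_span_mpolyX (K : fieldType) n (I : finType) (P : pred I)
    (e : I -> 'X_{1..n}) (m : 'X_{1..n}) :
  ideal_span P (fun i => 'X_[K, e i]) 'X_[K, m] <->
  exists2 i, P i & (e i <= m)%MM.
Proof.
split=> [[c Em]|[i Pi em]].
  apply: contrapT => none.
  have /eqP := congr1 (mcoeff m) Em.
  rewrite mcoeffX eqxx raddf_sum big1 ?oner_eq0 // => i Pi /=.
  apply/memN_msupp_eq0; rewrite (perm_mem (msuppMX _ _)).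
  apply/negP => /mapP[m' _ Em']; apply: none; exists i => //.
  by apply/mnm_lepP => j; rewrite Em' mnmDE leq_addr.
exists (fun j => if j == i then 'X_[(m - e i)%MM] else 0).
rewrite (bigD1 i) //= eqxx -mpolyXD submK // big1 ?addr0 // => j /andP[_ /negbTE->].
by rewrite mul0r.
Qed.

Lemma Mideal_mpolyX (K : fieldType) n k (m : 'X_{1..n}) :
  Mideal K n k 'X_[K, m] <->
  exists2 sigma : {set 'I_n}, (1 <= #|sigma| <= k + 1)%N &
    forall i, i \in sigma -> (n - #|sigma| + 1 <= m i)%N.
Proof.
rewrite /Mideal; have -> : msigma K n = (fun sigma =>
    'X_[(\sum_(i in sigma) U_(i) *+ (n - #|sigma| + 1))%MM]).
  by apply/funext => sigma; exact: msigmaE.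
rewrite ideal_span_mpolyX; split=> -[sigma sk sm]; exists sigma => //.
  by move=> i si; move/mnm_lepP/(_ i): sm; rewrite msigma_exponent si mul1n.
apply/mnm_lepP => i; rewrite msigma_exponent.
by case: (boolP (i \in sigma)) => [/sm|_]; rewrite ?mul1n.
Qed.

Lemma count_mnm n (m : 'X_{1..n}) (a : pred nat) :
  count a (multinom_val m) = #|[set i | a (m i)]|.
Proof.
rewrite cardE size_filter -(map_tnth_enum (multinom_val m)) count_map enumT.
by apply: eq_count => i; rewrite /= inE.
Qed.

(** A set of size [j + 1] has threshold [n - j], so a violating one exists exactly when more than
    [j] exponents reach [n - j]. *)
Lemma Mideal_mpolyX_count (K : fieldType) n k (m : 'X_{1..n}) : (k < n)%N ->
  ~ Mideal K n k 'X_[K, m] <->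
  forall j, (j <= k)%N -> (count (leq (n - j)) (multinom_val m) <= j)%N.
Proof.
move=> kn; rewrite Mideal_mpolyX; split=> [nM j jk|jM [sigma /andP[s0 sk] sm]].
  rewrite leqNgt count_mnm; apply/negP => jlt; apply: nM.
  have [sigma sub card_s] : exists2 sigma : {set 'I_n},
      sigma \subset [set i | (n - j <= m i)%N] & #|sigma| = j.+1.
    have /card_geqP[s [us ss sA]] := jlt.
    exists [set i in s]; first by apply/fintype.subsetP => i; rewrite inE => /sA.
    by rewrite cardsE (card_uniqP us).
  exists sigma; first by rewrite card_s addn1.
  rewrite card_s addn1 => i /(fintype.subsetP sub).
  by rewrite inE -subnSK // (leq_trans _ kn).
have := jM #|sigma|.-1; rewrite -ltnS prednK // -addn1 => /(_ sk).
rewrite count_mnm -ltnS prednK // ltnNge => /negP; apply.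
apply/subset_leq_card/fintype.subsetP => i /sm; rewrite inE; apply: leq_trans.
lia.
Qed.

(** The entries at least [c] form a prefix of [s]; past its end the default 0 is below [c]. *)
Lemma count_leq_sorted s j c : sorted geq s -> (0 < c)%N ->
  (count (leq c) s <= j)%N = (nth 0%N s j < c)%N.
Proof.
move=> + c0; elim: s j => [|x s IHs] j ss /=; first by rewrite nth_nil c0.
have [cx|xc] := leqP c x.
  case: j => [|j] /=; first by rewrite ltnNge cx.
  by rewrite add1n ltnS IHs // (path_sorted ss).
have tgeq : transitive geq by move=> a b d ab bd; exact: leq_trans bd ab.
have /allP sx := order_path_min tgeq ss.
have small y : y \in x :: s -> (y < c)%N.
  by rewrite inE => /predU1P[-> //|/sx yx]; exact: leq_ltn_trans yx xc.
have -> : count (leq c) s = 0%N.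
  apply/eqP; rewrite -leqn0 leqNgt -has_count -all_predC.
  by apply/allP => y ys; rewrite /= -ltnNge small // inE ys orbT.
rewrite leq0n; symmetry.
have [js|js] := ltnP j (size (x :: s)); first exact/small/mem_nth.
by rewrite nth_default.
Qed.

(** * Orbits as sorted exponent sequences *)

Lemma mpolyX_inj (K : fieldType) n : injective (fun m : 'X_{1..n} => 'X_[K, m]).
Proof.
move=> m m' /(congr1 (mcoeff m)) /eqP; rewrite !mcoeffX eqxx.
by case: (m' =P m) => [->//|_]; rewrite oner_eq0.
Qed.

Lemma perm_orbit_mpolyX (K : fieldType) n (m m' : 'X_{1..n}) :
  perm_orbit 'X_[K, m] = perm_orbit 'X_[K, m'] <->
  perm_eq (multinom_val m) (multinom_val m').
Proof.
split=> [E|/tuple_permP[p Ep]].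
  have : perm_orbit 'X_[K, m] 'X_[K, m] by exists 1%g; rewrite msym1m.
  rewrite E => -[p]; rewrite msymX => /mpolyX_inj ->.
  by apply/tuple_permP; exists p^-1%g.
(* [msym] permutes exponents by the inverse permutation. *)
have -> : 'X_[K, m] = msym p^-1%g 'X_[K, m'].
  rewrite msymX invgK; congr 'X_[_]; apply/mnmP => i.
  by rewrite mnmE mnm_tnth (val_inj Ep) tnth_mktuple.
apply/seteqP; split=> _ [q ->]; first by exists (p^-1 * q)%g; rewrite msymMm.
by exists (p * q)%g; rewrite msymMm -(msymMm _ p^-1%g) mulVg msym1m.
Qed.

(** Counting from 0, entry [j] has bound [max (n - k, n - j)]; for [j > k] this is [n - k],
    inherited from entry [k] by monotonicity. *)
Lemma mem_descents_count n k s : (k < n)%N ->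
  (s \in descents (maxn (n - k)) n n.+1) <->
  [/\ size s = n, sorted geq s &
      forall j, (j <= k)%N -> (count (leq (n - j)) s <= j)%N].
Proof.
move=> kn; rewrite mem_descents orbT /=; split.
  case/and3P=> /eqP ss ps /allP sb; have sort_s := path_sorted ps.
  split=> // j jk; rewrite count_leq_sorted //; last lia.
  have jn : (j < n)%N by lia.
  have /sb : j \in iota 0 n by rewrite mem_iota.
  by move/leq_trans; apply; rewrite geq_max; lia.
case=> ss sort_s cs.
have bound j : (j <= k)%N -> (nth 0%N s j < n - j)%N.
  by move=> jk; rewrite -count_leq_sorted ?cs //; lia.
have tgeq : transitive geq by move=> a b d ab bd; exact: leq_trans bd ab.
rewrite ss eqxx /=; apply/andP; split.
  have := bound 0%N isT; case: s sort_s {ss cs bound} => //= x s -> xn.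
  by rewrite andbT ltnW // -(subn0 n).
apply/allP => j; rewrite mem_iota /= add0n => jn; rewrite leq_max.
have [jk|kj] := leqP j k; first by rewrite bound ?orbT.
rewrite (leq_ltn_trans _ (bound k (leqnn k))) //.
by apply: (sorted_leq_nth tgeq leqnn _ sort_s); rewrite ?inE ?ss // ltnW.
Qed.

Definition mnm_of_seq n (s : seq nat) : 'X_{1..n} := [multinom nth 0%N s i | i < n].

Lemma val_mnm_of_seq n s : size s = n -> multinom_val (mnm_of_seq n s) = s :> seq nat.
Proof.
move=> ss; apply: (@eq_from_nth _ 0%N); first by rewrite size_tuple ss.
move=> i; rewrite size_tuple => i_n.
by rewrite -[i]/(val (Ordinal i_n)) -tnth_nth -mnm_tnth mnmE.
Qed.

Lemma stan_orbits_descents (K : fieldType) n k : (k < n)%N ->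
  stan_orbits K n k =
  [set perm_orbit 'X_[K, mnm_of_seq n s] | s in [set` descents (maxn (n - k)) n n.+1]]%classic.
Proof.
move=> kn; apply/seteqP; split=> [_ [_ [[m ->] mM] <-]|_ [s sD <-]].
  have sort_m : sorted geq (sort geq (multinom_val m)).
    by apply: sort_sorted => a b; exact: leq_total.
  have sz : size (sort geq (multinom_val m)) = n by rewrite size_sort size_tuple.
  exists (sort geq (multinom_val m)).
    apply/mem_descents_count => //; split=> // j jk.
    by rewrite count_sort; move/Mideal_mpolyX_count: mM => /(_ kn); apply.
  by apply/perm_orbit_mpolyX; rewrite val_mnm_of_seq // perm_sort.
have [ss _ cs] := (mem_descents_count s kn).1 sD.
exists 'X_[mnm_of_seq n s] => //; split; first by exists (mnm_of_seq n s).
by apply/Mideal_mpolyX_count => // j /cs; rewrite val_mnm_of_seq.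
Qed.

(** Sequences giving the same orbit are permutations of each other and, being sorted, coincide. *)
Lemma card_stan_orbits (K : fieldType) n k : (k < n)%N ->
  card_eq (stan_orbits K n k) `I_(size (descents (maxn (n - k)) n n.+1)).
Proof.
move=> kn; set D := descents _ _ _.
have memD i : (i < size D)%N ->
    size (nth [::] D i) = n /\ sorted geq (nth [::] D i).
  by move=> iD; have [] := (mem_descents_count _ kn).1 (mem_nth [::] iD).
have -> : stan_orbits K n k =
    [set perm_orbit 'X_[K, mnm_of_seq n (nth [::] D i)] | i in `I_(size D)]%classic.
  rewrite stan_orbits_descents //; apply/seteqP; split=> [_ [s sD <-]|_ [i iD <-]].
    by exists (index s D); rewrite /= ?index_mem // nth_index.
  by exists (nth [::] D i) => //; exact: mem_nth.
apply: inj_card_eq => i j; rewrite !inE /= => iD jD /perm_orbit_mpolyX.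
have [[si oi] [sj oj]] := (memD _ iD, memD _ jD).
rewrite !val_mnm_of_seq // => ij; apply/eqP.
rewrite -(nth_uniq [::] iD jD (uniq_descents _ _ _)); apply/eqP.
apply: (sorted_eq _ _ oi oj ij) => [a b d ab bd|a b].
  exact: leq_trans bd ab.
by rewrite andbC; exact: anti_leq.
Qed.

Theorem theorem2p4 (K : fieldType) (n k : nat)
    (hn : (1 <= n)%N) (hk : (k <= n - 1)%N) :
  exists N : nat,
    card_eq (stan_orbits K n k) `I_N /\
    N%:R = \sum_(1 <= l < k + 2)
             l%:R / (k + 1)%:R * 'C(2 * k + 1 - l, k)%:R
               * 'C(2 * (n - k) + l - 2, n - k + l - 1)%:R :> rat.
Proof.
have kn : (k < n)%N by lia.
exists (size (descents (maxn (n - k)) n n.+1)); split; first exact: card_stan_orbits.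
(* Here [m = n - k] and [t = k], and the start [n + 1] is [m + s] with [s = k + 1]. *)
have := @size_descents_ballot (n - k) k k.+1 (leqnn _).
rewrite addnS subnK ?(ltnW kn) // => ->.
rewrite addn2; apply: eq_big_nat => l lk.
by rewrite ballotE // !addn1.
Qed.
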